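(* Let $\alpha$ and $\beta$ be non-zero complex numbers. Assume that $m\alpha+n\beta=0$ for some relatively prime positive integers $m$ and $n$. Let $c\in \mathbb{C}/(\mathbb{Z}\alpha+\mathbb{Z}\beta)$ and let $(p,q)$ be a $c$-integral solution to $$( * )\qquad p(u)q(u)=p(u+\beta)q(u+\alpha).$$ Then there exist a unique $k\in\mathbb{Z}_{\ge 0}$ and a unique sequence $\big((\pi_1,\lambda_1),(\pi_2,\lambda_2),\ldots,(\pi_k,\lambda_k)\big)$ of elements of $\mathscr{D}(m,n)\times c$ with $$(\pi_1,\lambda_1)\preceq (\pi_2,\lambda_2)\preceq\cdots\preceq (\pi_k,\lambda_k)$$ such that $$(p,q)=\left(P^{\pi_1,\lambda_1}_1,\, P^{\pi_1,\lambda_1}_2 \right)\left(P^{\pi_2,\lambda_2}_1,\, P^{\pi_2,\lambda_2}_2 \right)\cdots\left(P^{\pi_k,\lambda_k}_1,\, P^{\pi_k,\lambda_k}_2 \right).$$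
   Context: Products of pairs are componentwise in $\mathbb{C}[u]\times\mathbb{C}[u]$. Integral solutions: let $c$ be a coset in $\mathbb{C}/(\mathbb{Z}\alpha+\mathbb{Z}\beta)$. A solution $(p,q)$ to $( * )$ in which $p,q\in\mathbb{C}[u]$ are non-zero and monic is called $c$-integral if every zero of $p(u)q(u)$ belongs to the coset $c$. Generalized Dyck paths: a lattice path is a sequence $\pi=\big((x_0,y_0),\ldots,(x_N,y_N)\big)$ with $(x_i,y_i)\in(\mathbb{Z}_{\ge 0})^2$ and $(x_{i+1},y_{i+1})\in\{(x_i+1,y_i),(x_i,y_i+1)\}$ for $i=0,\ldots,N-1$. $\mathscr{D}(m,n)$ is the set of generalized Dyck paths with end point $(m,n)$, i.e. lattice paths with $(x_0,y_0)=(0,0)$, end point $(x_N,y_N)=(m,n)$ (so $N=m+n$) and $my_i\ge nx_i$ for all $i$. The polynomials: for $\pi=\big((x_0,y_0),\ldots,(x_{m+n},y_{m+n})\big)\in\mathscr{D}(m,n)$, $\lambda\in\mathbb{C}$ and $\varepsilon\in\{1,2\}$, $$P_\varepsilon^{\pi,\lambda}(u)=\prod_{i=1}^{m+n} \big(u-(\lambda+x_i\alpha+y_i\beta)\big)^{\delta_{\varepsilon,1}\delta_{x_i,x_{i-1}}+\delta_{\varepsilon,2}\delta_{y_i,y_{i-1}}},$$ with $\delta$ the Kronecker delta. The partial order $\preceq$: let $Y=\mathbb{Z}^2/\mathbb{Z}(m,n)$ be the discrete cylinder and write $\overline{(x,y)}$ for the image of $(x,y)\in\mathbb{Z}^2$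 in $Y$. A cylindrical Dyck path is a sequence of points of $Y$ of the form $$\overline{\pi}_{kl}=\left(\overline{(x_0+k,y_0+l)},\overline{(x_1+k,y_1+l)},\ldots,\overline{(x_{m+n}+k,y_{m+n}+l)}\right)$$ where $\pi=\big((x_0,y_0),\ldots,(x_{m+n},y_{m+n})\big)\in\mathscr{D}(m,n)$ and $(k,l)\in\{0,1,\ldots,m-1\}\times\mathbb{Z}$. The set of these is denoted $\mathscr{D}^{\mathrm{cyl}}(m,n)$. For $\overline{\pi},\overline{\tau}\in\mathscr{D}^{\mathrm{cyl}}(m,n)$ one defines $\overline{\pi}\preceq\overline{\tau}$ if and only if, whenever $(x,y),(x',y')\in\mathbb{Z}^2$ are such that $\overline{(x,y)}$ is a point on $\overline{\pi}$ and $\overline{(x',y')}$ is a point on $\overline{\tau}$, one has: $x+y=x'+y'$ implies $y-x\le y'-x'$. For a fixed choice of origin $z_0\in c$ there is a bijection $\mathscr{D}(m,n)\times c\to\mathscr{D}^{\mathrm{cyl}}(m,n)$, $(\pi,z_0+k\alpha+l\beta)\mapsto\overline{\pi}_{kl}$ (with $(k,l)\in\{0,\ldots,m-1\}\times\mathbb{Z}$). The partial order $\preceq$ on $\mathscr{D}(m,n)\times c$ is the one transported through this bijection; it does not depend on the choice of $z_0$. *)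

(* Defs.v *)
From mathcomp Require Import all_boot all_order all_algebra.
From mathcomp Require Import boolp classical_sets reals.
From mathcomp Require Export complex.

Set Implicit Arguments.
Unset Strict Implicit.
Unset Printing Implicit Defensive.

Import GRing.Theory.
Local Open Scope ring_scope.
Local Open Scope classical_set_scope.

Section Solutions.
Variables (C : fieldType) (alpha beta : C).

Definition lattice : set C :=
  [set w | exists k l : int, w = alpha *~ k + beta *~ l].

(* The elements of the quotient group C / (Z alpha + Z beta), as subsets of C *)
Definition lattice_quotient : set (set C) :=
  [set c | exists z, c = [set z + w | w in lattice]].

Definition is_solution (p q : {poly C}) : Prop :=
  p * q = (p \Po ('X + beta%:P)) * (q \Po ('X + alpha%:P)).

Definition integral_solution (c : set C) (p q : {poly C}) : Prop :=
  [/\ is_solution p q,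
      (p != 0) && (q != 0),
      (p \is monic) && (q \is monic)
    & forall z, root (p * q) z -> c z].

End Solutions.

Definition lattice_step (a b : nat * nat) : bool :=
  (b == (a.1.+1, a.2)) || (b == (a.1, a.2.+1)).

Definition dyck_path (m n : nat) (s : (m + n).+1.-tuple (nat * nat)) : bool :=
  [&& sorted lattice_step s, head (0, 0)%N s == (0, 0)%N,
      last (0, 0)%N s == (m, n)
    & all (fun a => n * a.1 <= m * a.2)%N s].

Definition dyck (m n : nat) : Type :=
  {s : (m + n).+1.-tuple (nat * nat) | dyck_path s}.

Section Paths.
Variables m n : nat.

Definition xcoord (pi : dyck m n) (i : nat) : nat := (nth (0, 0)%N (val pi) i).1.
Definition ycoord (pi : dyck m n) (i : nat) : nat := (nth (0, 0)%N (val pi) i).2.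

Definition dyck_poly (C : fieldType) (alpha beta : C) (eps : nat)
    (pi : dyck m n) (lambda : C) : {poly C} :=
  \prod_(1 <= i < (m + n).+1)
    ('X - (lambda + alpha *+ xcoord pi i + beta *+ ycoord pi i)%:P) ^+
      ((eps == 1%N) * (xcoord pi i == xcoord pi i.-1)
       + (eps == 2%N) * (ycoord pi i == ycoord pi i.-1))%N.

(* The image of (x, y) in Y = Z^2 / Z(m, n), as a coset: equality in Y is
   equality of sets *)
Definition cyl_point (a : int * int) : set (int * int) :=
  [set b | exists t : int, b = (a.1 + m%:Z * t, a.2 + n%:Z * t)].

(* A finite sequence of points of Y is a tuple of cosets *)
Definition cyl_path : Type := (m + n).+1.-tuple (set (int * int)).

Definition cyl_dyck (pi : dyck m n) (k l : int) : cyl_path :=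
  [tuple cyl_point ((xcoord pi i)%:Z + k, (ycoord pi i)%:Z + l)
     | i < (m + n).+1].

Definition cyl_le (P Q : cyl_path) : Prop :=
  forall x y x' y' : int,
    (exists i, tnth P i = cyl_point (x, y)) ->
    (exists j, tnth Q j = cyl_point (x', y')) ->
    x + y = x' + y' -> (y - x <= y' - x')%R.

Section Order.
Variables (C : fieldType) (alpha beta : C) (c : set C) (z0 : C).

(* The graph of the bijection from D(m,n) x c to the cylindrical Dyck paths
   that is determined by the origin z0 *)
Definition cyl_graph (a : dyck m n * c) (P : cyl_path) : Prop :=
  exists (k : 'I_m) (l : int),
    val a.2 = z0 + alpha *+ k + beta *~ l /\ P = cyl_dyck a.1 k%:Z l.

Definition pair_le (a b : dyck m n * c) : Prop :=
  exists P Q, [/\ cyl_graph a P, cyl_graph b Q & cyl_le P Q].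

End Order.

End Paths.

(* Main.v *)
(* Since gcd(m, n) = 1, the coset c is {z0 + t beta / m | t in Z}, and Y is
   identified with Z by (x, y) |-> m y - n x, so that a vertical step is
   t -> t + m and a horizontal one t -> t - n. Recording a zero of p (resp. q)
   at t as a unit of flow on the edge t - m -> t (resp. t + n -> t) turns the
   equation into conservation of flow: Dyck paths with a base point are closed
   trajectories going once around, meeting every class modulo m + n once, and
   the order compares two trajectories inside each class. The occupied points
   that are minimal in their class form such a trajectory, starting at the
   global minimum; the corresponding pair of polynomials divides (p, q), and the
   quotient is again a solution. In any increasing factorization, the first
   path must consist of these minimal points, so existence and uniqueness follow
   together by induction on the degree. *)

Require Import Defs.
From mathcomp Require Import all_boot all_order all_algebra.
From mathcomp Require Import boolp classical_sets reals complex.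
From mathcomp Require Import zify ring.

Set Implicit Arguments.
Unset Strict Implicit.
Unset Printing Implicit Defensive.

Import Order.TTheory GRing.Theory Num.Theory.
Local Open Scope ring_scope.
Local Open Scope classical_set_scope.

(** * Coordinates along a Dyck path *)

Section DyckCoordinates.
Variables (m n : nat) (pi : dyck m n).

Lemma dyck_start : xcoord pi 0 = 0%N /\ ycoord pi 0 = 0%N.
Proof.
rewrite /xcoord /ycoord; case: pi => s /= /and4P[_ /eqP + _ _].
by rewrite -nth0 => ->.
Qed.

Lemma dyck_end : xcoord pi (m + n) = m /\ ycoord pi (m + n) = n.
Proof.
rewrite /xcoord /ycoord; case: pi => s /= /and4P[_ _ /eqP + _].
by rewrite -nth_last size_tuple => ->.
Qed.

Lemma dyck_above i : (i <= m + n)%N -> (n * xcoord pi i <= m * ycoord pi i)%N.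
Proof.
rewrite /xcoord /ycoord; case: pi => s /= /and4P[_ _ _ /allP h] le_i.
by apply: h; apply: mem_nth; rewrite size_tuple.
Qed.

Lemma dyck_step i : (i < m + n)%N ->
  (xcoord pi i.+1 = (xcoord pi i).+1 /\ ycoord pi i.+1 = ycoord pi i) \/
  (xcoord pi i.+1 = xcoord pi i /\ ycoord pi i.+1 = (ycoord pi i).+1).
Proof.
rewrite /xcoord /ycoord; case: pi => s /= /and4P[/sortedP - /(_ (0, 0)%N) h _ _ _] lt_i.
have lt_i1 : (i.+1 < size s)%N by rewrite size_tuple.
by have /orP[/eqP-> | /eqP->] := h i lt_i1; [left | right].
Qed.

Lemma coord_sum i : (i <= m + n)%N -> (xcoord pi i + ycoord pi i)%N = i.
Proof.
elim: i => [_|i IHi lt_i]; first by have [-> ->] := dyck_start.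
by have := IHi (ltnW lt_i); case: (dyck_step lt_i) => -[-> ->]; lia.
Qed.

End DyckCoordinates.

Lemma dyck_inj m n (pi tau : dyck m n) :
    (forall i, (i <= m + n)%N -> xcoord pi i = xcoord tau i) -> pi = tau.
Proof.
move=> eq_x; apply/val_inj/eq_from_tnth => i.
have le_i : (i <= m + n)%N by rewrite -ltnS.
have := eq_x i le_i; have := coord_sum pi le_i; have := coord_sum tau le_i.
rewrite !(tnth_nth (0, 0)%N) /xcoord /ycoord.
by case: (nth _ _ _) => ? ?; case: (nth _ _ _) => ? ? /= e e' ex; congr pair; lia.
Qed.

Lemma ex_seq_min (s : seq int) x : x \in s ->
  exists2 y, y \in s & forall z, z \in s -> y <= z.
Proof.
elim: s x => // h s IHs x _; have [->|[x1 x1s]] : s = [::] \/ exists x1, x1 \in s.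
- by case: s {IHs} => [|x1 s]; [left | right; exists x1; rewrite mem_head].
- by exists h; rewrite ?mem_head // => z; rewrite inE => /eqP->.
have [y ys min_y] := IHs _ x1s; case: (leP h y) => [hy|/ltW yh].
  exists h; rewrite ?mem_head // => z; rewrite inE => /predU1P[-> //|/min_y].
  exact: le_trans.
by exists y; rewrite ?inE ?ys ?orbT // => z; rewrite inE => /predU1P[->|/min_y].
Qed.

(** The equation is multiplicative in the pair and polynomials form a domain, so the factor of one
    path can be divided out during the induction. *)
Lemma solution_cancel (C : fieldType) (alpha beta : C) (p1 q1 p q : {poly C}) :
    p1 * q1 != 0 -> is_solution alpha beta p1 q1 ->
    is_solution alpha beta (p1 * p) (q1 * q) -> is_solution alpha beta p q.
Proof.
rewrite /is_solution => nz1 sol1; rewrite !comp_polyM mulrACA [in RHS]mulrACA -sol1.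
exact: mulfI.
Qed.

(** * The coset as a copy of the integers *)

Section ResonantLattice.
Variables (C : numClosedFieldType) (alpha beta : C) (m n : nat).
Hypotheses (hbeta : beta != 0) (hm : (0 < m)%N) (hmn : coprime m n).
Hypothesis hab : m%:R * alpha + n%:R * beta = 0.
Variables (c : set C) (z0 : C).
Hypotheses (hc : lattice_quotient alpha beta c) (hz0 : c z0).

Definition site (t : int) : C := z0 + (beta / m%:R) *~ t.

Let mC0 : m%:R != 0 :> C.
Proof. by rewrite pnatr_eq0 -lt0n. Qed.

Let bezout : exists u v : int, u * m%:Z + v * n%:Z = 1.
Proof.
have [u [v e]] := Bezoutz m%:Z n%:Z; exists u, v; rewrite e.
by rewrite /gcdz /= (eqP hmn).
Qed.

Lemma site_inj : injective site.
Proof.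
move=> s t /addrI /eqP; rewrite -subr_eq0 -mulrzBr mulrz_eq0 subr_eq0.
by rewrite mulf_eq0 invr_eq0 (negPf hbeta) (negPf mC0) !orbF => /eqP.
Qed.

(** With g = beta / m the resonance relation gives alpha = - n g and beta = m g, so lattice
    translations become integer shifts. *)
Lemma site_shift t (x y : int) :
  site t + alpha *~ x + beta *~ y = site (t + m%:Z * y - n%:Z * x).
Proof.
set g := beta / m%:R.
have ea : alpha = - (n%:R * g).
  apply: (mulfI mC0); rewrite mulrN mulrCA /g [_ * (_ / _)]mulrC mulfVK //.
  by apply/eqP; rewrite -addr_eq0 hab.
have eb : beta = m%:R * g by rewrite mulrC mulfVK.
rewrite /site -/g {1}ea {1}eb; move: g {ea eb} => g.
rewrite -!(mulrzr g) -(mulrzr (- _)) -(mulrzr (m%:R * g)).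
rewrite !(rmorphB, rmorphD, rmorphM) /= -!pmulrn.
ring.
Qed.

Lemma siteDm t : site (t + m%:Z) = site t + beta.
Proof.
rewrite -[in RHS](addr0 (site t)) -(mulr0z alpha) -[beta in RHS]mulr1z site_shift.
by congr site; lia.
Qed.

Lemma siteBn t : site (t - n%:Z) = site t + alpha.
Proof.
rewrite -[in RHS](addr0 (site t + _)) -(mulr0z beta) -[alpha in RHS]mulr1z.
by rewrite site_shift; congr site; lia.
Qed.

(** Bezout's u m + v n = 1 gives beta / m = u beta - v alpha, so the step of [site] lies in the
    lattice; by [site_shift] it generates it. *)
Lemma coset_siteP z : c z <-> exists t, z = site t.
Proof.
have [w ew] := hc; have [u [v uv]] := bezout.
have [_ [k0 [l0 ->]] ez0] : [set w + x | x in lattice alpha beta] z0 by rewrite -ew.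
have sub x y : w + (alpha *~ x + beta *~ y) =
    site (0 + m%:Z * (y - l0) - n%:Z * (x - k0)).
  by rewrite -site_shift /site mulr0z -ez0 !mulrzBr; ring.
rewrite ew; split=> [[_ [k [l ->]] <-]|[t ->]]; first by rewrite sub; eexists.
exists (alpha *~ (k0 - v * t) + beta *~ (l0 + u * t)).
  by exists (k0 - v * t), (l0 + u * t).
by rewrite sub; congr site; rewrite -[RHS]mul1r -uv; ring.
Qed.

(** An inverse of [site] on the coset; the default 0 is taken only off the coset. *)
Definition site_index (z : C) : int := xget 0 [set t | z = site t].

Lemma site_indexK z : c z -> site (site_index z) = z.
Proof.
move=> /coset_siteP cz; rewrite /site_index; symmetry.
exact: (@xgetPex _ 0 [set t | z = site t] cz).
Qed.

(** * Heights of a based path and their classes modulo m + n *)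

Definition height (a : dyck m n * c) (i : nat) : int :=
  site_index (val a.2) + m%:Z * (ycoord a.1 i)%:Z - n%:Z * (xcoord a.1 i)%:Z.

Lemma site_height a i :
  val a.2 + alpha *+ xcoord a.1 i + beta *+ ycoord a.1 i = site (height a i).
Proof.
by rewrite -site_shift site_indexK ?pmulrn //; apply: set_mem; exact: valP.
Qed.

Lemma height0 a : height a 0 = site_index (val a.2).
Proof. by rewrite /height; have [-> ->] := dyck_start a.1; lia. Qed.

Lemma height_end a : height a (m + n) = height a 0.
Proof. by rewrite height0 /height; have [-> ->] := dyck_end a.1; lia. Qed.

Lemma height_ge a i : (i <= m + n)%N -> height a 0 <= height a i.
Proof. by move=> /(dyck_above a.1); rewrite height0 /height; lia. Qed.

(** Eliminating y through x + y = i leaves x with coefficient m + n: modulo m + n the height is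
    affine in the index alone. *)
Lemma heightE a i : (i <= m + n)%N ->
  height a i = site_index (val a.2) + m%:Z * i%:Z - (m + n)%:Z * (xcoord a.1 i)%:Z.
Proof.
move=> /(coord_sum a.1) e; rewrite /height.
by rewrite -[in m%:Z * i%:Z]e !PoszD; ring.
Qed.

Definition congr_height (s t : int) : Prop := exists d : int, t = s + (m + n)%:Z * d.

Definition on_path (a : dyck m n * c) (t : int) : Prop :=
  exists2 i, (i <= m + n)%N & t = height a i.

Definition below (a b : dyck m n * c) : Prop :=
  forall s t, on_path a s -> on_path b t -> congr_height s t -> s <= t.

(** Rewriting u m + v n = 1 as (u - v) m = 1 - v (m + n) shows that m is invertible modulo m + n. *)
Let comMn : exists u : int, congr_height 1 (u * m%:Z).
Proof.
have [u [v uv]] := bezout; exists (u - v); exists (- v).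
by rewrite PoszD -uv; ring.
Qed.

Lemma height_congr_index a i j : (i <= m + n)%N -> (j <= m + n)%N ->
  congr_height (height a i) (height a j) -> congr_height i%:Z j%:Z.
Proof.
move=> le_i le_j [d]; rewrite !heightE // => e; have [u [w uw]] := comMn.
exists (u * (d + (xcoord a.1 j)%:Z - (xcoord a.1 i)%:Z) - w * (j%:Z - i%:Z)).
transitivity (j%:Z * (1 + (m + n)%:Z * w) - (m + n)%:Z * w * j%:Z); first by ring.
rewrite -uw.
have ->: j%:Z * (u * m%:Z) =
  u * (i%:Z * m%:Z + (m + n)%:Z * (d + (xcoord a.1 j)%:Z - (xcoord a.1 i)%:Z)).
  by rewrite mulrCA; congr (_ * _); lia.
rewrite mulrDr mulrCA.
by rewrite uw; ring.
Qed.

Lemma height_uniq a i j : (0 < i <= m + n)%N -> (0 < j <= m + n)%N ->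
  congr_height (height a i) (height a j) -> i = j.
Proof.
move=> /andP[i0 le_i] /andP[j0 le_j] /(height_congr_index le_i le_j)[d e].
(* Indices from 1 to m + n differ by less than m + n; index 0 is left out because the closed path
   repeats it at m + n. *)
have d0 : d = 0 by nia.
by move: e; rewrite d0 mulr0 addr0 => -[].
Qed.

Lemma on_path_pos a t : on_path a t ->
  exists2 i, (0 < i <= m + n)%N & t = height a i.
Proof.
move=> [[|i] le_i ->]; last by exists i.+1.
by exists (m + n)%N; rewrite ?height_end ?leqnn ?addn_gt0 ?hm.
Qed.

Lemma on_path_uniq a s t : on_path a s -> on_path a t -> congr_height s t -> s = t.
Proof.
by move=> /on_path_pos[i hi ->] /on_path_pos[j hj ->] /(height_uniq hi hj) ->.
Qed.

Lemma on_path_ge a t : on_path a t -> height a 0 <= t.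
Proof. by move=> [i le_i ->]; apply: height_ge. Qed.

Lemma on_path_hit a t : exists2 s, on_path a s & congr_height t s.
Proof.
have [u [w uw]] := comMn; pose b := site_index (val a.2).
(* The index sought solves b + m k = t modulo m + n, and u inverts m. *)
pose k := (u * (t - b) %% (m + n)%:Z)%Z.
pose q := (u * (t - b) %/ (m + n)%:Z)%Z.
have M0 : (m + n)%:Z != 0 by lia.
have eq_k : k = u * (t - b) - (m + n)%:Z * q.
  have := divz_eq (u * (t - b)) (m + n)%:Z; rewrite -/k -/q => ->; ring.
have k0 : 0 <= k by apply: modz_ge0.
have kM : k < (m + n)%:Z by apply: ltz_pmod; lia.
have le_k : (`|k|%N <= m + n)%N by lia.
exists (height a `|k|); first by exists `|k|%N.
exists (w * (t - b) - m%:Z * q - (xcoord a.1 `|k|)%:Z).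
rewrite heightE // gez0_abs // eq_k.
have ->: m%:Z * (u * (t - b) - (m + n)%:Z * q) =
  (u * m%:Z) * (t - b) - m%:Z * (m + n)%:Z * q by ring.
by rewrite uw; ring.
Qed.

Lemma congr_heightC s t : congr_height s t -> congr_height t s.
Proof. by move=> [d ->]; exists (- d); ring. Qed.

Lemma congr_height_trans r s t :
  congr_height r s -> congr_height s t -> congr_height r t.
Proof. by move=> [d ->] [e ->]; exists (d + e); ring. Qed.

(** The middle path meets the class of s, which supplies the intermediate point of the
    comparison. *)
Lemma below_trans b a d : below a b -> below b d -> below a d.
Proof.
move=> ab bd s t as_ dt st; have [r br sr] := on_path_hit b s.
apply: le_trans (ab _ _ as_ br sr) (bd _ _ br dt _).
exact: congr_height_trans (congr_heightC sr) st.
Qed.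

(** Each base is the lowest point of its path, so the bases agree; then points of equal index are
    congruent, hence of equal height, and the abscissas agree by [heightE]. *)
Lemma below_anti a b : below a b -> below b a -> a = b.
Proof.
have base a' b' : below a' b' -> below b' a' -> height b' 0 <= height a' 0.
  move=> ab ba; have a0 : on_path a' (height a' 0) by exists 0%N.
  have [s bs s0] := on_path_hit b' (height a' 0).
  exact: le_trans (on_path_ge bs) (ba _ _ bs a0 (congr_heightC s0)).
move=> ab ba; have e0 : site_index (val a.2) = site_index (val b.2).
  by rewrite -!height0; apply: le_anti; rewrite !base.
have ex i : (i <= m + n)%N -> xcoord a.1 i = xcoord b.1 i.
  move=> le_i; have on a' : on_path a' (height a' i) by exists i.
  have cab : congr_height (height a i) (height b i).
    by rewrite !heightE // e0; exists ((xcoord a.1 i)%:Z - (xcoord b.1 i)%:Z); ring.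
  have := le_anti (introT andP (conj (ab _ _ (on a) (on b) cab)
    (ba _ _ (on b) (on a) (congr_heightC cab)))).
  by rewrite !heightE // e0; nia.
case: a b {ab ba} e0 ex => [pi x] [tau y] /=; move=> exy ex.
congr pair; first exact: dyck_inj.
apply: val_inj; rewrite -[LHS]site_indexK ?exy ?site_indexK //;
  by apply: set_mem; exact: valP.
Qed.

(** * The discrete cylinder and the order on it *)

Lemma cyl_point_eqP (x y x' y' : int) :
  cyl_point m n (x, y) = cyl_point m n (x', y') <->
  m%:Z * y - n%:Z * x = m%:Z * y' - n%:Z * x'.
Proof.
split=> [e|e].
  have : cyl_point m n (x, y) (x, y) by exists 0; rewrite /= !mulr0 !addr0.
  by rewrite e => -[t [-> ->]] /=; ring.
have [u [v uv]] := bezout.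
(* If the difference of the points is d (m, n), Bezout forces d to be this combination. *)
pose d := u * (x - x') + v * (y - y').
have ex : x = x' + m%:Z * d.
  apply: subr0_eq; transitivity ((x - x') * (1 - u * m%:Z) - v * (m%:Z * (y - y'))).
    by rewrite /d; ring.
  by rewrite -uv (_ : m%:Z * (y - y') = n%:Z * (x - x')); [ring | lia].
have ey : y = y' + n%:Z * d.
  apply: subr0_eq; transitivity ((y - y') * (1 - v * n%:Z) - u * (n%:Z * (x - x'))).
    by rewrite /d; ring.
  by rewrite -uv (_ : n%:Z * (x - x') = m%:Z * (y - y')); [ring | lia].
rewrite ex ey; apply/seteqP; split=> [[b1 b2] [t /= [-> ->]]|[b1 b2] [t /= [-> ->]]].
  by exists (d + t) => /=; congr pair; ring.
by exists (t - d) => /=; congr pair; ring.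
Qed.

Lemma cyl_graph_points (a : dyck m n * c) P (x y : int) : cyl_graph alpha beta z0 a P ->
  (exists i, tnth P i = cyl_point m n (x, y)) <-> on_path a (m%:Z * y - n%:Z * x).
Proof.
move=> [k [l [ea ->]]].
have e0 : site_index (val a.2) = m%:Z * l - n%:Z * k%:Z.
  apply: site_inj; rewrite site_indexK; last by apply: set_mem; exact: valP.
  by rewrite ea -[m%:Z * l]add0r -site_shift /site mulr0z addr0 pmulrn.
have pt i : m%:Z * ((ycoord a.1 i)%:Z + l) - n%:Z * ((xcoord a.1 i)%:Z + k%:Z) =
    height a i by rewrite /height e0; ring.
split=> [[j]|[i le_i e]].
  rewrite tnth_mktuple => /cyl_point_eqP; rewrite pt => <-.
  by exists j => //; rewrite -ltnS.
have lt_i : (i < (m + n).+1)%N by [].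
by exists (Ordinal lt_i); rewrite tnth_mktuple; apply/cyl_point_eqP; rewrite pt e.
Qed.

(** The base index t must be written as m l - n k with 0 <= k < m: take for k the residue of - v t
    modulo m and absorb the quotient in l. *)
Lemma cyl_graph_total (a : dyck m n * c) : exists P, cyl_graph alpha beta z0 a P.
Proof.
have [u [v uv]] := bezout; pose t := site_index (val a.2).
have m0 : m%:Z != 0 by lia.
have k0 : 0 <= (- v * t %% m%:Z)%Z by apply: modz_ge0.
have km : (- v * t %% m%:Z < m%:Z)%Z by apply: ltz_pmod.
have [k ek] : exists k : 'I_m, k%:Z = (- v * t %% m%:Z)%Z.
  have lt_k : (`|(- v * t %% m%:Z)%Z| < m)%N by lia.
  by exists (Ordinal lt_k) => /=; lia.
pose l := u * t - n%:Z * (- v * t %/ m%:Z)%Z.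
exists (cyl_dyck a.1 k%:Z l), k, l; split=> //.
have <- : site t = val a.2 by rewrite site_indexK //; apply: set_mem; exact: valP.
have <- : site 0 = z0 by rewrite /site mulr0z addr0.
rewrite pmulrn site_shift; congr site.
have -> : k%:Z = - v * t - m%:Z * (- v * t %/ m%:Z)%Z.
  rewrite ek; have := divz_eq (- v * t) m%:Z.
  by move: (_ %/ _)%Z (_ %% _)%Z => r s ->; ring.
by rewrite /l -[LHS]mul1r -uv; ring.
Qed.

(* In terms of the invariant [m y - n x], the points of [Y] on one antidiagonal
   form a class modulo [m + n], ordered by [y - x]. *)
Lemma pair_leP a b : pair_le alpha beta z0 a b <-> below a b.
Proof.
split=> [[P [Q [aP bQ PQ]]] s t as_ bt [d e]|ab].
  have [u [v uv]] := bezout.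
  (* Bezout lifts s to the point (- v s, u s); adding (- d, d) stays on its antidiagonal and adds (m
     + n) d to m y - n x. *)
  have es : s = m%:Z * (u * s) - n%:Z * (- (v * s)) by rewrite -[LHS]mul1r -uv; ring.
  have et : t = m%:Z * (u * s + d) - n%:Z * (- (v * s) - d).
    by rewrite e {1}es PoszD; ring.
  have := PQ (- (v * s)) (u * s) (- (v * s) - d) (u * s + d).
  rewrite (cyl_graph_points _ _ aP) (cyl_graph_points _ _ bQ) -es -et.
  move=> /(_ as_ bt ltac:(ring)) h; have d0 : 0 <= d by lia.
  by rewrite e lerDl mulr_ge0.
have [P aP] := cyl_graph_total a; have [Q bQ] := cyl_graph_total b.
exists P, Q; split=> // x y x' y'.
rewrite (cyl_graph_points _ _ aP) (cyl_graph_points _ _ bQ) => on_a on_b exy.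
have := ab _ _ on_a on_b _.
have -> : x' = x - (y' - y) by lia.
case: (ltP (y' - y) 0) => [lt_y|]; last by lia.
move=> h; have {h} := h ltac:(exists (y' - y); rewrite PoszD; lia).
by nia.
Qed.

Lemma pair_le_asboolE a b :
  `[< pair_le alpha beta z0 a b >] = `[< below a b >].
Proof. exact/asbool_equiv_eq/pair_leP. Qed.

(** * Polynomials attached to a path *)

Let fac a i : {poly C} := 'X - (site (height a i))%:P.

Lemma dyck_poly1E a : dyck_poly alpha beta 1 a.1 (val a.2) =
  \prod_(1 <= i < (m + n).+1 | xcoord a.1 i == xcoord a.1 i.-1) fac a i.
Proof.
rewrite [RHS]big_mkcond; apply: eq_bigr => i _.
by rewrite site_height mul1n mul0n addn0; case: eqP.
Qed.

Lemma dyck_poly2E a : dyck_poly alpha beta 2 a.1 (val a.2) =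
  \prod_(1 <= i < (m + n).+1 | ycoord a.1 i == ycoord a.1 i.-1) fac a i.
Proof.
rewrite [RHS]big_mkcond; apply: eq_bigr => i _.
by rewrite site_height mul1n mul0n add0n; case: eqP.
Qed.

Lemma dyck_stepE (a : dyck m n * c) i : (0 < i < (m + n).+1)%N ->
  ((xcoord a.1 i == xcoord a.1 i.-1) = false /\ ycoord a.1 i == ycoord a.1 i.-1
     /\ height a i.-1 = height a i + n%:Z) \/
  (xcoord a.1 i == xcoord a.1 i.-1 /\ (ycoord a.1 i == ycoord a.1 i.-1) = false
     /\ height a i.-1 = height a i - m%:Z).
Proof.
case: i => //= i lt_i; rewrite /height.
by case: (dyck_step a.1 lt_i) => -[-> ->]; [left | right]; (split; [lia | split; lia]).
Qed.

Lemma dyck_polyM a :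
  dyck_poly alpha beta 1 a.1 (val a.2) * dyck_poly alpha beta 2 a.1 (val a.2) =
  \prod_(1 <= i < (m + n).+1) fac a i.
Proof.
rewrite dyck_poly1E dyck_poly2E [X in X * _]big_mkcond.
rewrite [X in _ * X]big_mkcond -big_split /=.
apply: eq_big_nat => i /dyck_stepE - /(_ a).
by case=> -[-> [-> _]]; rewrite ?mul1r ?mulr1.
Qed.

Lemma root_dyck_poly a t :
  root (dyck_poly alpha beta 1 a.1 (val a.2) * dyck_poly alpha beta 2 a.1 (val a.2))
    (site t) <-> on_path a t.
Proof.
rewrite dyck_polyM -(big_map (fun i => site (height a i)) xpredT (fun z => 'X - z%:P)).
rewrite root_prod_XsubC; split=> [/mapP[j]|/on_path_pos[i hi ->]].
  by rewrite mem_index_iota ltnS => /andP[_ hj] /site_inj ->; exists j.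
by apply/mapP; exists i => //; rewrite mem_index_iota ltnS.
Qed.

(** The two translations move the factor at the end of a step to its start, so the right-hand side
    is the product over starting points; on a closed path these are the end points again. *)
Lemma dyck_poly_solution (a : dyck m n * c) :
  is_solution alpha beta (dyck_poly alpha beta 1 a.1 (val a.2))
    (dyck_poly alpha beta 2 a.1 (val a.2)).
Proof.
have fac_comp i (b : C) t : site t + b = site (height a i) ->
    fac a i \Po ('X + b%:P) = 'X - (site t)%:P.
  by move=> e; rewrite /fac comp_polyB comp_polyX comp_polyC -e polyCD; ring.
rewrite /is_solution dyck_polyM dyck_poly1E dyck_poly2E.
rewrite !rmorph_prod /= [X in _ = X * _]big_mkcond [X in _ = _ * X]big_mkcond.
rewrite -big_split /=.
transitivity (\prod_(1 <= i < (m + n).+1) fac a i.-1).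
  rewrite big_add1 [RHS]big_add1 /=.
  (* Completed by one factor, both products run over the indices 0 to m + n; the added factors
     coincide since the path closes. *)
  have : fac a 0 * \prod_(0 <= i < m + n) fac a i.+1 =
         \prod_(0 <= i < m + n) fac a i * fac a (m + n).
    by rewrite -big_nat_recl // big_nat_recr.
  have -> : fac a (m + n) = fac a 0 by rewrite /fac height_end.
  rewrite mulrC => /mulIf -> //.
  by rewrite polyXsubC_eq0.
apply: eq_big_nat => i /dyck_stepE - /(_ a).
case=> -[-> [-> e]]; rewrite ?mul1r ?mulr1 /fac.
  by rewrite (fac_comp _ _ (height a i.-1)) // e -siteBn addrK.
by rewrite (fac_comp _ _ (height a i.-1)) // e -siteDm subrK.
Qed.

Lemma dyck_poly_monic (a : dyck m n * c) eps :
  dyck_poly alpha beta eps a.1 (val a.2) \is monic.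
Proof. by apply: monic_prod => i _; apply: monic_exp; apply: monicXsubC. Qed.

Lemma size_dyck_polyM (a : dyck m n * c) :
  size (dyck_poly alpha beta 1 a.1 (val a.2) * dyck_poly alpha beta 2 a.1 (val a.2))
    = (m + n).+1.
Proof. by rewrite dyck_polyM size_prod_XsubC size_iota subn1. Qed.

(** The heights at indices 1 to m + n are distinct, so the product has simple roots and it suffices
    that each be a root of f. *)
Lemma dvdp_height_prod a (P : pred nat) (f : {poly C}) :
  (forall i, (i < m + n)%N -> P i.+1 -> root f (site (height a i.+1))) ->
  \prod_(1 <= i < (m + n).+1 | P i) fac a i %| f.
Proof.
move=> root_f; rewrite -big_filter.
rewrite -(big_map (fun i => site (height a i)) xpredT (fun z => 'X - z%:P)).
apply: uniq_roots_dvdp.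
  apply/allP => _ /mapP[j + ->]; rewrite mem_filter mem_index_iota.
  by case: j => [|j] /andP[Pj /andP[//_ lt_j]]; apply: root_f.
rewrite uniq_rootsE map_inj_in_uniq ?filter_uniq ?iota_uniq // => i j.
rewrite !mem_filter !mem_index_iota !ltnS => /andP[_ hi] /andP[_ hj] /site_inj e.
by apply: (height_uniq (a := a) hi hj); exists 0; rewrite e mulr0 addr0.
Qed.

(** * The trajectory of minimal occupied points *)

Section LowestPath.
Variables p q : {poly C}.
Hypothesis hpq : is_solution alpha beta p q.

Let occupied t := root (p * q) (site t).

Lemma occupied_in t : occupied t = root p (site t) || root q (site t).
Proof. by rewrite /occupied rootM. Qed.

(** The functional equation enters here: its right-hand side at t reads p one vertical step ahead
    and q one horizontal step ahead, so flow entering t also leaves it. *)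
Lemma occupied_out t :
  occupied t = root p (site (t + m%:Z)) || root q (site (t - n%:Z)).
Proof.
by rewrite /occupied hpq siteDm siteBn rootM /root !horner_comp !hornerE.
Qed.

Definition lowest t : Prop :=
  occupied t /\ forall s, occupied s -> congr_height t s -> t <= s.

(** An occupied s in the class of t - n has an occupied predecessor, s - m or s + n, in the class of
    t, and minimality of t bounds that one from below. *)
Lemma lowest_next_right t : lowest t -> root q (site (t - n%:Z)) -> lowest (t - n%:Z).
Proof.
move=> [_ min_t] qt; split=> [|s]; first by rewrite occupied_in qt orbT.
rewrite occupied_in => /orP[ps|qs] [d e].
  have := min_t (s - m%:Z).
  rewrite occupied_out subrK ps => /(_ isT) h.
  by have := h ltac:(exists (d - 1); rewrite e PoszD; ring); lia.
have := min_t (s + n%:Z).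
rewrite occupied_out addrK qs orbT => /(_ isT) h.
by have := h ltac:(exists d; rewrite e PoszD; ring); lia.
Qed.

Lemma lowest_next_up t : lowest t -> ~~ root q (site (t - n%:Z)) ->
  root p (site (t + m%:Z)) /\ lowest (t + m%:Z).
Proof.
move=> [+ min_t] qt; rewrite occupied_out (negPf qt) orbF => pt.
split=> //; split=> [|s]; first by rewrite occupied_in pt.
rewrite occupied_in => /orP[ps|qs] [d e].
  have := min_t (s - m%:Z).
  rewrite occupied_out subrK ps => /(_ isT) h.
  by have := h ltac:(exists d; rewrite e PoszD; ring); lia.
have := min_t (s + n%:Z).
rewrite occupied_out addrK qs orbT => /(_ isT) h.
have {}h := h ltac:(exists (d + 1); rewrite e PoszD; ring).
(* The bound still allows d = -1, that is s = t - n; but s is a zero of q and t - n is not. *)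
have d1 : d != -1 by apply: contraNneq qt => d1; rewrite (_ : t - n%:Z = s) // e d1; lia.
by nia.
Qed.

Lemma lowest_path_exists t0 : occupied t0 -> (forall s, occupied s -> t0 <= s) ->
  exists a : dyck m n * c,
    [/\ forall t, on_path a t -> lowest t,
        dyck_poly alpha beta 1 a.1 (val a.2) %| p
      & dyck_poly alpha beta 2 a.1 (val a.2) %| q].
Proof.
move=> occ0 min0; pose ht (z : nat * nat) : int := t0 + m%:Z * z.2%:Z - n%:Z * z.1%:Z.
(* Greedy walk from the global minimum: step right whenever q has a zero there; otherwise
   [lowest_next_up] allows a step up. *)
pose next z := if root q (site (ht z - n%:Z)) then (z.1.+1, z.2) else (z.1, z.2.+1).
pose pt i := iter i next (0, 0)%N.
have ptS i : pt i.+1 = next (pt i) by [].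
have ht_right z : ht (z.1.+1, z.2) = ht z - n%:Z.
  by rewrite /ht /= -addn1 PoszD; ring.
have ht_up z : ht (z.1, z.2.+1) = ht z + m%:Z.
  by rewrite /ht /= -addn1 PoszD; ring.
have low i : lowest (ht (pt i)).
  elim: i => [|i IHi].
    rewrite (_ : ht _ = t0); last by rewrite /ht /=; ring.
    by split=> // s /min0.
  rewrite ptS /next; case: ifPn => qi.
    by rewrite ht_right; apply: lowest_next_right.
  by rewrite ht_up; have [] := lowest_next_up IHi qi.
have sum i : ((pt i).1 + (pt i).2)%N = i.
  by elim: i => [//|i IHi]; rewrite ptS /next; case: ifP => _ /=; lia.
(* After m + n steps the height is congruent to t0 and both are minimal in that class, so they are
   equal; with x + y = m + n this gives (m, n). *)
have ptM : pt (m + n)%N = (m, n).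
  have e := sum (m + n)%N.
  have [occM minM] := low (m + n)%N; have := min0 _ occM.
  have := minM _ occ0; rewrite /ht => h1 h2.
  have {}h1 := h1 ltac:(exists ((pt (m + n)%N).1%:Z - m%:Z); nia).
  by rewrite [LHS]surjective_pairing; congr pair; nia.
have size_s : size (traject next (0, 0)%N (m + n).+1) == (m + n).+1.
  by rewrite size_traject.
have path_s : dyck_path (Tuple size_s).
  apply/and4P; split=> //.
  - apply: (@sub_path _ (frel next)); last exact: fpath_traject.
    by move=> z _ /eqP <-; rewrite /lattice_step /next; case: ifP; rewrite eqxx ?orbT.
  - by rewrite /= last_traject -/(pt _) ptM.
  (* Occupied heights are at least t0, which is the Dyck condition. *)
  - apply/allP => z /(@trajectP _ next (0, 0)%N (m + n).+1)[i _ ->].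
    have [/min0 + _] := low i; rewrite /ht /pt /=; case: (iter _ _ _) => x y /=; lia.
have cx i : (i <= m + n)%N -> nth (0, 0)%N (traject next (0, 0)%N (m + n).+1) i = pt i.
  by move=> le_i; rewrite nth_traject.
have c_t0 : site t0 \in c by apply/mem_set/coset_siteP; exists t0.
pose a : dyck m n * c := (exist (fun s => dyck_path s) _ path_s,
  exist (fun z => z \in c) _ c_t0).
have xa i : (i <= m + n)%N -> xcoord a.1 i = (pt i).1 by move=> /cx <-.
have ya i : (i <= m + n)%N -> ycoord a.1 i = (pt i).2 by move=> /cx <-.
have ha i : (i <= m + n)%N -> height a i = ht (pt i).
  move=> le_i; have -> : ht (pt i) =
      site_index (val a.2) + m%:Z * (pt i).2%:Z - n%:Z * (pt i).1%:Z.
    rewrite /ht; congr (_ + _ - _); apply: site_inj; rewrite site_indexK //.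
    by apply/coset_siteP; exists t0.
  by rewrite /height xa ?ya.
exists a; split=> [t [i le_i ->]||]; first by rewrite ha.
- rewrite dyck_poly1E; apply: dvdp_height_prod => i lt_i.
  rewrite ha // [i.+1.-1]/= !xa ?(ltnW lt_i) // ptS /next.
  case: ifPn => qi /=; first by rewrite (gtn_eqF (ltnSn _)).
  by rewrite ht_up; have [] := lowest_next_up (low i) qi.
- rewrite dyck_poly2E; apply: dvdp_height_prod => i lt_i.
  rewrite ha // [i.+1.-1]/= !ya ?(ltnW lt_i) // ptS /next.
  case: ifPn => qi /=; last by rewrite (gtn_eqF (ltnSn _)).
  by rewrite ht_right.
Qed.

End LowestPath.

(** * Existence and uniqueness of the ordered factorization *)

Lemma root_prod_dyck_poly (s : seq (dyck m n * c)) (p q : {poly C}) :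
  (p, q) = \prod_(a <- s) (dyck_poly alpha beta 1 a.1 (val a.2),
                           dyck_poly alpha beta 2 a.1 (val a.2)) ->
  forall t, root (p * q) (site t) -> exists2 a, List.In a s & on_path a t.
Proof.
elim: s p q => [|a s IHs] p q.
  by rewrite big_nil => -[-> ->] t; rewrite mulr1 (negPf (root1 _)).
rewrite big_cons; case: (\prod_(b <- s) _) IHs => p' q' IHs [-> ->] t.
rewrite mulrACA rootM => /orP[/root_dyck_poly|/(IHs _ _ erefl)[b bs]] on_t.
  by exists a => //; left.
by exists b => //; right.
Qed.

(** By algebraic closedness [p * q] has a zero; its zeros are finitely many and lie in the coset, so
    one has least index, and the walk starts there. *)
Lemma solution_lowest_path p q : integral_solution alpha beta c p q ->
  size (p * q) != 1 -> exists a : dyck m n * c,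
    [/\ forall t, on_path a t -> lowest p q t,
        dyck_poly alpha beta 1 a.1 (val a.2) %| p
      & dyck_poly alpha beta 2 a.1 (val a.2) %| q].
Proof.
move=> [sol /andP[p0 q0] _ int_pq] sz.
have [r er] := closed_field_poly_normal (p * q).
have rootE z : root (p * q) z = (z \in r).
  by rewrite er rootZ ?lead_coef_eq0 ?mulf_neq0 // root_prod_XsubC.
have [z] : exists z, root (p * q) z by apply/closed_rootP.
rewrite rootE => /(map_f site_index)/ex_seq_min[t0 /mapP[z0' z0r ->] min_t0].
have site_z0' : site (site_index z0') = z0'.
  by rewrite site_indexK //; apply: int_pq; rewrite rootE.
apply: (lowest_path_exists sol (t0 := site_index z0')).
  by rewrite site_z0' rootE.
move=> s; rewrite rootE => /(map_f site_index) /min_t0; congr (_ <= _).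
by apply: site_inj; rewrite site_indexK //; apply/coset_siteP; exists s.
Qed.

(** A minimal point lies below every occupied point of its class, so each path is below the
    other. *)
Lemma lowest_path_unique p q a b : (forall t, on_path a t -> lowest p q t) ->
  (forall t, on_path b t -> lowest p q t) -> a = b.
Proof.
by move=> la lb; apply: below_anti => s t;
  [move=> /la[_ h] /lb[/h{}h _] | move=> /lb[_ h] /la[/h{}h _]].
Qed.

(** Every zero of [p * q] lies on some path of the sequence, and by transitivity all of these are
    above the head. This pins down the head in any ordered factorization. *)
Lemma sorted_head_lowest a s p q :
  sorted (fun a b => `[< pair_le alpha beta z0 a b >]) (a :: s) ->
  (p, q) = \prod_(b <- a :: s) (dyck_poly alpha beta 1 b.1 (val b.2),
                                dyck_poly alpha beta 2 b.1 (val b.2)) ->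
  forall t, on_path a t -> lowest p q t.
Proof.
move=> sort_as epq t at_; split.
  move: epq; rewrite big_cons; case: (\prod_(b <- s) _) => p' q' [-> ->].
  by rewrite mulrACA rootM; apply/orP; left; apply/root_dyck_poly.
have tr : transitive (fun a b : dyck m n * c => `[< pair_le alpha beta z0 a b >]).
  move=> b a' d /=; rewrite !pair_le_asboolE => /asboolP ab /asboolP bd.
  exact/asboolP/(below_trans ab bd).
have ab b : List.In b s -> below a b.
  move=> bs; apply/asboolP; rewrite -pair_le_asboolE; move: (order_path_min tr sort_as).
  by elim: s bs {sort_as epq} => //= h s IHs [->|/IHs h'] /andP[//].
move=> u /(root_prod_dyck_poly epq)[b [<-|/ab h] bu] tu; last exact: h.
by rewrite (on_path_uniq at_ bu tu).
Qed.

Lemma unique_decomposition p q : integral_solution alpha beta c p q ->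
  exists! s : seq (dyck m n * c),
    sorted (fun a b => `[< pair_le alpha beta z0 a b >]) s /\
    (p, q) = \prod_(a <- s)
      (dyck_poly alpha beta 1 a.1 (val a.2),
       dyck_poly alpha beta 2 a.1 (val a.2)).
Proof.
have [N] := ubnP (size (p * q)); elim: N p q => // N IHN p q szN ipq.
have [sol /andP[p0 q0] /andP[mp mq] int_pq] := ipq.
have [sz1|sz1] := eqVneq (size (p * q)) 1.
  have [p1 q1] : p = 1 /\ q = 1.
    have monic1 (f : {poly C}) : f \is monic -> size f == 1 -> f = 1.
      move=> /monicP lf /eqP sf; move: lf.
      by rewrite (size1_polyC (eq_leq sf)) lead_coefC => ->.
    by have /eqP := sz1; rewrite size_mul_eq1 => /andP[sp sq]; split; apply: monic1.
  exists [::]; split=> [|s [_]]; first by rewrite big_nil p1 q1.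
  case: s => // a s; rewrite big_cons; case: (\prod_(b <- s) _) => p' q' [ep eq].
  (* A nonempty product would have degree at least m + n > 0. *)
  have : dyck_poly alpha beta 1 a.1 (val a.2) *
         dyck_poly alpha beta 2 a.1 (val a.2) %| p * q.
    by rewrite ep eq mulrACA dvdp_mulr.
  by move=> /(dvdp_leq (mulf_neq0 p0 q0)); rewrite sz1 size_dyck_polyM; lia.
have [a [low_a /dvdpP[p' ep] /dvdpP[q' eq]]] := solution_lowest_path ipq sz1.
set p1 := dyck_poly _ _ 1 _ _ in ep; set q1 := dyck_poly _ _ 2 _ _ in eq.
have [mp1 mq1] : p1 \is monic /\ q1 \is monic by split; apply: dyck_poly_monic.
have ipq' : integral_solution alpha beta c p' q'.
  split.
  - apply: (@solution_cancel _ alpha beta p1 q1).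
    + by rewrite mulf_neq0 ?monic_neq0.
    + exact: dyck_poly_solution.
    + by rewrite [p1 * _]mulrC [q1 * _]mulrC -ep -eq.
  - by move: p0 q0; rewrite ep eq !mulf_eq0 !negb_or => /andP[-> _] /andP[-> _].
  - by move: mp mq; rewrite ep eq !monicMr // => -> ->.
  - by move=> z rz; apply: int_pq; rewrite ep eq mulrACA rootM rz.
have szN' : (size (p' * q')%R < N)%N.
  have [_ /andP[p'0 q'0] _ _] := ipq'.
  move: szN; rewrite ep eq mulrACA [X in (X < _)%N]size_Mmonic ?mulf_neq0 ?monicMl //.
  rewrite (size_dyck_polyM a : size (p1 * q1) = _) addnS ltnS; apply: leq_trans.
  by rewrite -[X in (X < _)%N]addn0 ltn_add2l addn_gt0 hm.
have [s [[sort_s es] uniq_s]] := IHN _ _ szN' ipq'.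
have epq : (p, q) = \prod_(b <- a :: s) (dyck_poly alpha beta 1 b.1 (val b.2),
                                dyck_poly alpha beta 2 b.1 (val b.2)).
  by rewrite big_cons -es ep eq [p' * _]mulrC [q' * _]mulrC.
exists (a :: s); split.
  split=> //; case: s sort_s es epq {uniq_s} => //= b s -> es epq.
  (* Only the first two paths remain to be compared: points of [b] are zeros of the quotient, hence
     occupied, and those of [a] are minimal in their class. *)
  rewrite andbT pair_le_asboolE; apply/asboolP => u v /low_a[_ min_u] bv.
  apply: min_u.
  rewrite ep eq mulrACA rootM; apply/orP; left.
  move: es; rewrite big_cons; case: (\prod_(b <- s) _) => p'' q'' [-> ->].
  by rewrite mulrACA rootM; apply/orP; left; apply/root_dyck_poly.
move=> [|b s2] [sort2 e2].
  by move: e2 sz1; rewrite big_nil => -[-> ->]; rewrite mulr1 size_poly1.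
(* Both heads consist of minimal points for (p, q), so they coincide; cancelling their monic factors
   leaves the tail to the induction hypothesis. *)
have eab : a = b := lowest_path_unique low_a (sorted_head_lowest sort2 e2).
rewrite -eab in sort2 e2 *; congr cons; apply: uniq_s; split.
  exact: path_sorted sort2.
move: e2; rewrite big_cons; case: (\prod_(b <- s2) _) => p'' q''.
rewrite ep eq [p' * _]mulrC [q' * _]mulrC => -[].
by move=> /(mulfI (monic_neq0 mp1)) -> /(mulfI (monic_neq0 mq1)) ->.
Qed.

End ResonantLattice.

Theorem theorem5p6 (R : realType) (alpha beta : R[i]) (m n : nat)
  (halpha : alpha != 0) (hbeta : beta != 0)
  (hm : (0 < m)%N) (hn : (0 < n)%N) (hmn : coprime m n)
  (hab : m%:R * alpha + n%:R * beta = 0)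
  (c : set R[i]) (hc : lattice_quotient alpha beta c)
  (z0 : R[i]) (hz0 : c z0)
  (p q : {poly R[i]}) (hpq : integral_solution alpha beta c p q) :
  exists! s : seq (dyck m n * c),
    sorted (fun a b => `[< pair_le alpha beta z0 a b >]) s /\
    (p, q) = \prod_(a <- s)
      (dyck_poly alpha beta 1 a.1 (val a.2),
       dyck_poly alpha beta 2 a.1 (val a.2)).
Proof. exact: unique_decomposition. Qed.
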